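(* Let $n\in\mathbb{N}$, $n\geq 2$. There is a computable abelian group $(G,+,0)$ and an element $b\in G$, $b\neq 0$, such that, if $c$ is a finite coloring of $G$ (with any finite number of colors) for which the equation $$(x_1-y_1)+\dots+(x_n-y_n)=b$$ has no pairwise monochromatic solutions and there is an integer $m>0$ such that all the elements $kmb$, $k\in\mathbb{Z}$, are colored by $c$ with the same color, then $c$ has PA degree.
   Context: A computable group is a group whose underlying set and group operations are computable. A finite coloring of $G$ is a map $c:G\to k=\{0,\dots,k-1\}$ for some $k\in\mathbb{N}$, $k>1$. A tuple $(x_1,y_1,\dots,x_n,y_n)\in G^{2n}$ is pairwise monochromatic for $c$ if $c(x_i)=c(y_i)$ for all $i=1,\dots,n$; a pairwise monochromatic solution of an equation is a solution that is pairwise monochromatic for $c$. A tree is a set of finite strings closed under initial segments; a binary tree is a tree contained in $2^{<\mathbb{N}}$. A set (or function) $X$ has PA degree if every computable infinite binary tree has an $X$-computable infinite path. *)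

(* Defs.v *)
From HB Require Import structures.
From mathcomp Require Import all_boot all_order all_algebra.
From Stdlib Require Cantor.

Set Implicit Arguments.
Unset Strict Implicit.
Unset Printing Implicit Defensive.

Import GRing.Theory.

(* Programs for the unary partial recursive functions relative to an oracle;
   several arguments are packed into one by the Cantor pairing function. *)
Inductive prog : Type :=
| Zero | Succ | Fst | Snd | Oracle
| Pair of prog & prog
| Comp of prog & prog
| Prec of prog & prog
| Mu of prog.

Definition npair (i j : nat) : nat := Cantor.to_nat (i, j).
Definition nfst (z : nat) : nat := (Cantor.of_nat z).1.
Definition nsnd (z : nat) : nat := (Cantor.of_nat z).2.

(* [eval X e x z]: program [e] with oracle [X] halts on input [x] with output
   [z].  In the [Prec] clause, [r i] is the value at stage [i] of the recursion
     h(a, 0) = f(a),   h(a, i + 1) = g(a, (i, h(a, i)));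
   only the values [r 0], ..., [r (nsnd x)] are constrained. *)
Fixpoint eval (X : nat -> nat) (e : prog) (x z : nat) : Prop :=
  match e with
  | Zero => z = 0
  | Succ => z = x.+1
  | Fst => z = nfst x
  | Snd => z = nsnd x
  | Oracle => z = X x
  | Pair f g => exists a b, [/\ eval X f x a, eval X g x b & z = npair a b]
  | Comp f g => exists y, eval X g x y /\ eval X f y z
  | Prec f g => exists r : nat -> nat,
      [/\ eval X f (nfst x) (r 0),
          forall i, i < nsnd x ->
            eval X g (npair (nfst x) (npair i (r i))) (r i.+1)
        & z = r (nsnd x)]
  | Mu f => eval X f (npair x z) 0 /\
      forall i, i < z -> exists y, eval X f (npair x i) y.+1
  end.

Definition computable_from (X f : nat -> nat) : Prop :=
  exists e : prog, forall x, eval X e x (f x).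

Definition computable (f : nat -> nat) : Prop :=
  computable_from (fun=> 0) f.

Definition computable2 (f : nat -> nat -> nat) : Prop :=
  computable (fun z => f (nfst z) (nsnd z)).

Definition computable_set (D : pred nat) : Prop :=
  computable (fun i => nat_of_bool (D i)).

(* Abelian groups whose underlying set is, via the bijection [gval], the set
   [gdom] of natural numbers. *)
Record natZmodType := NatZmodType {
  gsort :> zmodType;
  gval : gsort -> nat;
  gof : nat -> option gsort;
  gvalK : pcancel gval gof;
  gofK : ocancel gof gval
}.

Definition gdom (G : natZmodType) : pred nat := fun i => isSome (gof G i).

(* The group operations and colorings, as functions on [nat]; they are given
   the irrelevant value 0 outside [gdom G], which is harmless for computability
   since [gdom G] is required to be computable. *)
Definition nat_add (G : natZmodType) (i j : nat) : nat :=
  if (gof G i, gof G j) is (Some x, Some y) then gval (x + y)%R else 0.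

Definition nat_opp (G : natZmodType) (i : nat) : nat :=
  if gof G i is Some x then gval (- x)%R else 0.

Definition nat_coloring (G : natZmodType) (r : nat) (c : G -> 'I_r)
    (i : nat) : nat :=
  if gof G i is Some x then nat_of_ord (c x) else 0.

Definition computable_group (G : natZmodType) : Prop :=
  [/\ computable_set (gdom G), computable2 (nat_add G)
    & computable (nat_opp G)].

Definition pairwise_monochromatic (G C : Type) (c : G -> C) (n : nat)
    (x y : {ffun 'I_n -> G}) : Prop :=
  forall i, c (x i) = c (y i).

Definition is_tree (T : pred (seq nat)) : Prop :=
  forall s t, prefix s t -> T t -> T s.

Definition binary_tree (T : pred (seq nat)) : Prop :=
  is_tree T /\ forall s, T s -> all (fun a => a < 2) s.

Definition computable_tree (T : pred (seq nat)) : Prop :=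
  computable_set (fun i => T (CodeSeq.decode i)).

Definition infinite_tree (T : pred (seq nat)) : Prop :=
  forall l : seq (seq nat), exists2 s, T s & s \notin l.

Definition infinite_path (T : pred (seq nat)) (f : nat -> nat) : Prop :=
  forall l, T (mkseq f l).

Definition PA_degree (X : nat -> nat) : Prop :=
  forall T : pred (seq nat),
    computable_tree T -> binary_tree T -> infinite_tree T ->
    exists2 f, computable_from X f & infinite_path T f.

(* Main.v *)
(* Let [G] be generated by [b] and one element [h_e] for each computation
   [e = (q, w, m)] of a program [q] on an input [w], with the relation
   [h_e = M_t b] (resp. [h_e = (M_t + 1) b]) if the computation halts with output
   zero (resp. nonzero), where [t >= m] codes [e] and its halting time, and
   [M_t = 3^t t!] is divisible by [1, ..., t].  Since [M] grows fast, generators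
   that halt late dominate a given word, so equality of words is decided by giving
   each [h_e] the value that it would have if its computation halted now.
   If the multiples of [m b] have color [j], then [h_e] has color [j] when the output
   is zero; when it is nonzero this is impossible, since
   [(h_e - 0) + (0 - M_t b) + 0 + ... + 0 = b].  So [c] separates the inputs on which
   [q] outputs 0 from those on which it outputs 1, for every [q].  Applied to a
   search for the first of two sibling subtrees which is found to be finite, this
   yields paths through computable binary trees. *)
Require Import Defs.
From HB Require Import structures.
From mathcomp Require Import all_boot all_order all_algebra.
From mathcomp Require Import zify.
From Stdlib Require Cantor.

Set Implicit Arguments.
Unset Strict Implicit.
Unset Printing Implicit Defensive.

Import GRing.Theory.

(** * Closure properties of relative computability *)

Arguments npair : simpl never.

Lemma nfst_pair i j : nfst (npair i j) = i.
Proof. by rewrite /nfst /npair Cantor.cancel_of_to. Qed.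

Lemma nsnd_pair i j : nsnd (npair i j) = j.
Proof. by rewrite /nsnd /npair Cantor.cancel_of_to. Qed.

Lemma npair_eta z : npair (nfst z) (nsnd z) = z.
Proof. by rewrite /npair /nfst /nsnd -surjective_pairing Cantor.cancel_to_of. Qed.

Lemma leq_npair i j : i + j <= npair i j.
Proof. by have := Cantor.to_nat_non_decreasing i j; rewrite /npair; lia. Qed.

Lemma npair_inj1 i j i' j' : npair i j = npair i' j' -> i = i'.
Proof. by move=> /(congr1 nfst); rewrite !nfst_pair. Qed.

Section Closure.

Variable X : nat -> nat.
Implicit Types f g h N : nat -> nat.

Notation cf := (computable_from X).

Lemma cf_ext f g : f =1 g -> cf f -> cf g.
Proof. by move=> fg [e He]; exists e => x; rewrite -fg. Qed.

Lemma cf_comp f g : cf f -> cf g -> cf (fun x => f (g x)).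
Proof.
by move=> [e He] [e' He']; exists (Comp e e') => x /=; exists (g x).
Qed.

Lemma cf_pair f g : cf f -> cf g -> cf (fun x => npair (f x) (g x)).
Proof.
by move=> [e He] [e' He']; exists (Pair e e') => x /=; exists (f x), (g x).
Qed.

Lemma cf_nfst f : cf f -> cf (fun x => nfst (f x)).
Proof. by apply: cf_comp; exists Fst. Qed.

Lemma cf_nsnd f : cf f -> cf (fun x => nsnd (f x)).
Proof. by apply: cf_comp; exists Snd. Qed.

Lemma cf_id : cf (fun x => x).
Proof.
apply: (@cf_ext (fun x => npair (nfst x) (nsnd x)) _ npair_eta).
by apply: cf_pair; [exists Fst | exists Snd].
Qed.

Lemma cf_succ f : cf f -> cf (fun x => (f x).+1).
Proof. by apply: (@cf_comp S); exists Succ. Qed.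

Lemma cf_const k : cf (fun=> k).
Proof. by elim: k => [|k IHk]; [exists Zero | apply: cf_succ]. Qed.

Lemma cf_oracle f : cf f -> cf (fun x => X (f x)).
Proof. by apply: cf_comp; exists Oracle. Qed.

Lemma cf_iteri N f (F : nat -> nat -> nat -> nat) : cf N -> cf f ->
  cf (fun z => F (nfst z) (nfst (nsnd z)) (nsnd (nsnd z))) ->
  cf (fun x => iteri (N x) (F x) (f x)).
Proof.
move=> cN [e He] [e' He'].
(* [Prec] takes its parameter and its number of rounds from a single input, so [x] is packed with
   [N x]. *)
apply: (@cf_ext (fun x => iteri (nsnd (npair x (N x)))
  (F (nfst (npair x (N x)))) (f (nfst (npair x (N x)))))).
  by move=> x; rewrite nfst_pair nsnd_pair.
apply: (@cf_comp (fun z => iteri (nsnd z) (F (nfst z)) (f (nfst z)))); last first.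
  by apply: cf_pair => //; apply: cf_id.
exists (Prec e e') => z /=.
exists (fun i => iteri i (F (nfst z)) (f (nfst z))); split=> // i _ /=.
have := He' (npair (nfst z) (npair i (iteri i (F (nfst z)) (f (nfst z))))).
by rewrite !nfst_pair !nsnd_pair nfst_pair.
Qed.

Lemma cf_iter N f (F : nat -> nat -> nat) : cf N -> cf f ->
  cf (fun z => F (nfst z) (nsnd z)) ->
  cf (fun x => iter (N x) (F x) (f x)).
Proof.
move=> cN cf_ cF.
apply: (@cf_ext (fun x => iteri (N x) (fun _ => F x) (f x))).
  by move=> x; elim: (N x) => //= k ->.
apply: cf_iteri => //.
apply: (@cf_ext (fun z => F (nfst (npair (nfst z) (nsnd (nsnd z))))
                           (nsnd (npair (nfst z) (nsnd (nsnd z)))))).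
  by move=> z; rewrite nfst_pair nsnd_pair.
apply: (@cf_comp (fun z => F (nfst z) (nsnd z))) => //.
by apply: cf_pair; do ?[apply: cf_nfst | apply: cf_nsnd]; apply: cf_id.
Qed.

Ltac base := do ?[apply: cf_nfst | apply: cf_nsnd | apply: cf_succ];
  do ?[exact: cf_id | exact: cf_const].

Lemma cf_add f g : cf f -> cf g -> cf (fun x => f x + g x).
Proof.
move=> cf_ cg; apply: (@cf_ext (fun x => iter (g x) succn (f x))).
  by move=> x; rewrite iter_succn.
by apply: cf_iter => //; base.
Qed.

Lemma cf_pred f : cf f -> cf (fun x => (f x).-1).
Proof.
move=> cf_; apply: (@cf_ext (fun x => iteri (f x) (fun i _ => i) 0)).
  by move=> x; case: (f x).
by apply: cf_iteri => //; base.
Qed.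

Lemma cf_sub f g : cf f -> cf g -> cf (fun x => f x - g x).
Proof.
move=> cf_ cg; apply: (@cf_ext (fun x => iter (g x) predn (f x))).
  by move=> x; rewrite iter_predn.
by apply: cf_iter => //; apply: cf_pred; base.
Qed.

Lemma cf_mul f g : cf f -> cf g -> cf (fun x => f x * g x).
Proof.
move=> cf_ cg; apply: (@cf_ext (fun x => iter (g x) (addn (f x)) 0)).
  by move=> x; rewrite iter_addn_0.
apply: cf_iter => //; base.
by apply: cf_add; last base; apply: (cf_comp cf_); base.
Qed.

Lemma cf_exp f g : cf f -> cf g -> cf (fun x => f x ^ g x).
Proof.
move=> cf_ cg; apply: (@cf_ext (fun x => iter (g x) (muln (f x)) 1)).
  by move=> x; rewrite iter_muln_1.
apply: cf_iter => //; base.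
by apply: cf_mul; last base; apply: (cf_comp cf_); base.
Qed.

Lemma cf_neg (b : pred nat) :
  cf (fun x => b x : nat) -> cf (fun x => ~~ b x : nat).
Proof.
move=> cb; apply: (@cf_ext (fun x => 1 - b x)); first by move=> x; case: (b x).
by apply: cf_sub => //; base.
Qed.

Lemma cf_and (b c : pred nat) : cf (fun x => b x : nat) ->
  cf (fun x => c x : nat) -> cf (fun x => b x && c x : nat).
Proof.
move=> cb cc; apply: (@cf_ext (fun x => b x * c x)); first by move=> x; rewrite mulnb.
exact: cf_mul.
Qed.

Lemma cf_or (b c : pred nat) : cf (fun x => b x : nat) ->
  cf (fun x => c x : nat) -> cf (fun x => b x || c x : nat).
Proof.
move=> cb cc; apply: (@cf_ext (fun x => ~~ (~~ b x && ~~ c x))).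
  by move=> x; rewrite negb_and !negbK.
by apply: cf_neg; apply: cf_and; apply: cf_neg.
Qed.

Lemma cf_eq0 f : cf f -> cf (fun x => f x == 0 : nat).
Proof.
move=> cf_; apply: (@cf_ext (fun x => 1 - f x)); first by move=> x; case: (f x).
by apply: cf_sub => //; base.
Qed.

Lemma cf_leq f g : cf f -> cf g -> cf (fun x => f x <= g x : nat).
Proof. by move=> cf_ cg; apply: cf_eq0; apply: cf_sub. Qed.

Lemma cf_eq f g : cf f -> cf g -> cf (fun x => f x == g x : nat).
Proof.
move=> cf_ cg; apply: (@cf_ext (fun x => (f x <= g x) && (g x <= f x))).
  by move=> x; rewrite -eqn_leq.
by apply: cf_and; apply: cf_leq.
Qed.

Lemma cf_if (b : pred nat) f g : cf (fun x => b x : nat) -> cf f -> cf g ->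
  cf (fun x => if b x then f x else g x).
Proof.
move=> cb cf_ cg; apply: (@cf_ext (fun x => b x * f x + ~~ b x * g x)).
  by move=> x; case: (b x); rewrite mul1n mul0n ?addn0.
by apply: cf_add; apply: cf_mul => //; apply: cf_neg.
Qed.

Lemma cf_odd f : cf f -> cf (fun x => odd (f x) : nat).
Proof.
move=> cf_; apply: (@cf_ext (fun x => iter (f x) (fun r => r == 0 : nat) 0)).
  by move=> x; elim: (f x) => //= k ->; case: (odd k).
by apply: cf_iter => //; base; apply: cf_eq0; base.
Qed.

Lemma cf_half f : cf f -> cf (fun x => (f x)./2).
Proof.
move=> cf_; apply: (@cf_ext (fun x => iteri (f x) (fun i r => odd i + r) 0)).
  by move=> x; elim: (f x) => //= k ->; rewrite uphalf_half.
by apply: cf_iteri => //; base; apply: cf_add; last base; apply: cf_odd; base.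
Qed.

Lemma cf_has N (P : nat -> pred nat) : cf N ->
  cf (fun z => P (nfst z) (nsnd z) : nat) ->
  cf (fun x => has (P x) (iota 0 (N x)) : nat).
Proof.
move=> cN cP.
apply: (@cf_ext (fun x => iteri (N x) (fun i r => ~~ (r == 0) || P x i) 0)).
  move=> x; elim: (N x) => // k IHk.
  by rewrite -[in RHS]addn1 iotaD has_cat /= orbF IHk; case: has.
apply: cf_iteri => //; base; apply: cf_or.
  by apply: cf_neg; apply: cf_eq0; base.
apply: (@cf_ext (fun z => P (nfst (npair (nfst z) (nfst (nsnd z))))
                           (nsnd (npair (nfst z) (nfst (nsnd z)))))).
  by move=> z; rewrite nfst_pair nsnd_pair.
by apply: (cf_comp cP); apply: cf_pair; base.
Qed.

Lemma cf_min (P : nat -> pred nat) (exP : forall x, exists i, P x i) :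
  cf (fun z => P (nfst z) (nsnd z) : nat) -> cf (fun x => ex_minn (exP x)).
Proof.
move=> /cf_neg[e He]; exists (Mu e) => x /=.
case: ex_minnP => k Pk min_k.
have eE i : eval X e (npair x i) (~~ P x i).
  by have := He (npair x i); rewrite nfst_pair nsnd_pair.
split; first by have := eE k; rewrite Pk.
move=> i lt_ik; exists 0; have := eE i.
by rewrite (contraNN (min_k i)) // -ltnNge.
Qed.

(** In contrast to [cf_min], witnesses may be missing for some [x], so [q] is in general only
    partial; it reports [b] at the least witness. *)
Lemma eval_search (P : nat -> pred nat) (b : nat -> pred nat) :
  cf (fun z => P (nfst z) (nsnd z) : nat) ->
  cf (fun z => b (nfst z) (nsnd z) : nat) ->
  exists q, forall x d, P x d ->
    exists2 k, P x k & eval X q x (b x k).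
Proof.
move=> /cf_neg[e He] [e' He'].
have [i Hi] := cf_id.
exists (Comp e' (Pair i (Mu e))) => x d Pd.
case: (ex_minnP (ex_intro _ d Pd)) => k Pk min_k.
have eE n : eval X e (npair x n) (~~ P x n).
  by have := He (npair x n); rewrite nfst_pair nsnd_pair.
exists k => //=; exists (npair x k); split; last first.
  by have := He' (npair x k); rewrite nfst_pair nsnd_pair.
exists x, k; split=> //; split; first by have := eE k; rewrite Pk.
move=> n lt_nk; exists 0; have := eE n.
by rewrite (contraNN (min_k n)) // -ltnNge.
Qed.

End Closure.

(** * A universal machine *)

Ltac computability := repeat first
  [ assumption | simple apply cf_id | simple apply cf_const | simple apply cf_pair
  | simple apply cf_nfst | simple apply cf_nsnd | simple apply cf_succ
  | simple apply cf_if | simple apply cf_neg | simple apply cf_and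
  | simple apply cf_or | simple apply cf_eq0 | simple apply cf_eq
  | simple apply cf_leq | simple apply cf_add | simple apply cf_pred
  | simple apply cf_mul | simple apply cf_sub | simple apply cf_exp
  | simple apply cf_odd | simple apply cf_half
  | simple apply cf_has | simple apply cf_iteri | simple apply cf_iter ].

(** * Lists of numbers coded as numbers *)

Definition lcons (a l : nat) : nat := (npair a l).+1.

(** A left fold run on pairs of a remaining list and an accumulator. As the code [l] bounds the
    length of its list, [l] rounds suffice; those after the end of the list change nothing. *)
Definition lfold (F : nat -> nat -> nat) (l a : nat) : nat :=
  nsnd (iter l (fun p => if nfst p == 0 then p else
    npair (nsnd (nfst p).-1) (F (nfst (nfst p).-1) (nsnd p))) (npair l a)).

Definition lcode (s : seq nat) : nat := foldr lcons 0 s.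

(** The tail has a smaller code, so strong induction applies. Hence words need no test of
    well-formedness. *)
Lemma lcode_surj l : exists s, l = lcode s.
Proof.
have [k] := ubnP l; elim: k l => // k IHk [|l] lt_lk; first by exists [::].
have [|s Es] := IHk (nsnd l); first by have := leq_npair (nfst l) (nsnd l); rewrite npair_eta; lia.
by exists (nfst l :: s); rewrite /= -Es /lcons npair_eta.
Qed.

Lemma size_lcode s : size s <= lcode s.
Proof. by elim: s => //= a s IHs; have := leq_npair a (lcode s); rewrite /lcons; lia. Qed.

Lemma lfold_code F s a : lfold F (lcode s) a = foldl (fun r x => F x r) a s.
Proof.
rewrite /lfold; move: {1 2}(lcode s) (size_lcode s) => k.
elim: s k a => [|x s IHs] k a /=.
  by move=> _; elim: k => [|k IHk]; rewrite ?nsnd_pair // iterSr /= !nfst_pair.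
case: k => // k le_sk; rewrite iterSr /= /lcons !(nfst_pair, nsnd_pair) /=.
exact: IHs.
Qed.

Lemma cf_lfold X (F : nat -> nat -> nat -> nat) l a :
  computable_from X l -> computable_from X a ->
  computable_from X (fun z => F (nfst z) (nfst (nsnd z)) (nsnd (nsnd z))) ->
  computable_from X (fun x => lfold (F x) (l x) (a x)).
Proof.
move=> cl ca cF; apply: cf_nsnd; apply: cf_iter; computability.
set l1 := fun z => nfst (nfst (nsnd z)).-1; set a1 := fun z => nsnd (nsnd z).
apply: (@cf_ext _ (fun z => F (nfst (npair (nfst z) (npair (l1 z) (a1 z))))
  (nfst (nsnd (npair (nfst z) (npair (l1 z) (a1 z)))))
  (nsnd (nsnd (npair (nfst z) (npair (l1 z) (a1 z))))))).
  by move=> z; rewrite !(nfst_pair, nsnd_pair).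
by apply: (cf_comp cF); rewrite /l1 /a1; computability.
Qed.

(* A machine state is [npair K v]: a value [v] and a stack [K] of frames
   [npair tag data].  Tags 0 to 7 are programs waiting for their input, the other
   ones are continuations: the second component of a pair is still to be computed
   (8) or being computed (9), and the loops of [Prec] (10) and [Mu] (11). *)
Fixpoint pcode (e : prog) : nat :=
  match e with
  | Zero | Oracle => npair 0 0
  | Succ => npair 1 0
  | Fst => npair 2 0
  | Snd => npair 3 0
  | Pair f g => npair 4 (npair (pcode f) (pcode g))
  | Comp f g => npair 5 (npair (pcode f) (pcode g))
  | Prec f g => npair 6 (npair (pcode f) (pcode g))
  | Mu f => npair 7 (pcode f)
  end.

Definition prec_frame (g a i n : nat) : nat :=
  npair 10 (npair g (npair a (npair i n))).

Definition mu_frame (f x i : nat) : nat := npair 11 (npair f (npair x i)).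

Definition act (tag d K v : nat) : nat :=
  let f := nfst d in let g := nsnd d in
  if tag == 0 then npair K 0
  else if tag == 1 then npair K v.+1
  else if tag == 2 then npair K (nfst v)
  else if tag == 3 then npair K (nsnd v)
  else if tag == 4 then npair (lcons f (lcons (npair 8 (npair g v)) K)) v
  else if tag == 5 then npair (lcons g (lcons f K)) v
  else if tag == 6 then
    npair (lcons f (lcons (prec_frame g (nfst v) 0 (nsnd v)) K)) (nfst v)
  else if tag == 7 then npair (lcons d (lcons (mu_frame d v 0) K)) (npair v 0)
  else if tag == 8 then npair (lcons f (lcons (npair 9 v) K)) g
  else if tag == 9 then npair K (npair d v)
  else let x := nfst g in
  if tag == 10 then
    let i := nfst (nsnd g) in let n := nsnd (nsnd g) in
    if i == n then npair K v
    else npair (lcons f (lcons (prec_frame f x i.+1 n) K)) (npair x (npair i v))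
  else let i := nsnd g in
    if v == 0 then npair K i
    else npair (lcons f (lcons (mu_frame f x i.+1) K)) (npair x i.+1).

Definition step (S : nat) : nat :=
  if nfst S == 0 then S else
  let fr := nfst (nfst S).-1 in
  act (nfst fr) (nsnd fr) (nsnd (nfst S).-1) (nsnd S).

Lemma step_cons t d K v : step (npair (lcons (npair t d) K) v) = act t d K v.
Proof. by rewrite /step nfst_pair /= /lcons !(nfst_pair, nsnd_pair). Qed.

Lemma cf_step X S : computable_from X S -> computable_from X (fun x => step (S x)).
Proof.
move=> cS; rewrite /step /act /lcons /prec_frame /mu_frame; cbv zeta.
by computability.
Qed.

Definition reach (S S' : nat) : Prop := exists n, iter n step S = S'.

Lemma reach_refl S : reach S S.
Proof. by exists 0. Qed.

Lemma reach_trans S2 S1 S3 : reach S1 S2 -> reach S2 S3 -> reach S1 S3.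
Proof. by move=> [n <-] [m <-]; exists (m + n); rewrite iterD. Qed.

Lemma reach_step S1 S2 : reach (step S1) S2 -> reach S1 S2.
Proof. by apply: reach_trans; exists 1. Qed.

(** The stack [K] is arbitrary so that the induction hypotheses apply to subprograms running above a
    continuation. [Oracle] may share the code of [Zero] because the oracle is constantly 0. *)
Lemma reach_eval e x z : eval (fun=> 0) e x z ->
  forall K, reach (npair (lcons (pcode e) K) x) (npair K z).
Proof.
elim: e x z => [||||| f IHf g IHg | f IHf g IHg | f IHf g IHg | f IHf] x z /=.
1,2,3,4,5: by move=> -> K; apply: reach_step; rewrite step_cons; exists 0.
- move=> [a [b [Hf Hg ->]]] K.
  apply: reach_step; rewrite step_cons /act /= !(nfst_pair, nsnd_pair).
  apply: (reach_trans (IHf _ _ Hf _)).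
  apply: reach_step; rewrite step_cons /act /= !(nfst_pair, nsnd_pair).
  apply: (reach_trans (IHg _ _ Hg _)).
  by apply: reach_step; rewrite step_cons; exists 0.
- move=> [y [Hg Hf]] K.
  apply: reach_step; rewrite step_cons /act /= !(nfst_pair, nsnd_pair).
  exact: (reach_trans (IHg _ _ Hg _) (IHf _ _ Hf _)).
- move=> [r [Hf Hg ->]] K.
  apply: reach_step; rewrite step_cons /act /= !(nfst_pair, nsnd_pair).
  apply: (reach_trans (IHf _ _ Hf _)).
  have loop i : i <= nsnd x ->
    reach (npair (lcons (prec_frame (pcode g) (nfst x) 0 (nsnd x)) K) (r 0))
          (npair (lcons (prec_frame (pcode g) (nfst x) i (nsnd x)) K) (r i)).
    elim: i => [|i IHi] lt_i; first exact: reach_refl.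
    apply: (reach_trans (IHi (ltnW lt_i))).
    apply: reach_step; rewrite step_cons /act /= !(nfst_pair, nsnd_pair).
    by rewrite ltn_eqF //; apply: IHg; apply: Hg.
  apply: (reach_trans (loop _ (leqnn _))).
  apply: reach_step; rewrite step_cons /act /= !(nfst_pair, nsnd_pair) eqxx.
  exact: reach_refl.
- move=> [Hf0 Hf1] K.
  apply: reach_step; rewrite step_cons /act /=.
  have loop i : i <= z ->
    reach (npair (lcons (pcode f) (lcons (mu_frame (pcode f) x 0) K)) (npair x 0))
          (npair (lcons (pcode f) (lcons (mu_frame (pcode f) x i) K)) (npair x i)).
    elim: i => [|i IHi] lt_i; first exact: reach_refl.
    apply: (reach_trans (IHi (ltnW lt_i))).
    have [y Hy] := Hf1 i lt_i; apply: (reach_trans (IHf _ _ Hy _)).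
    apply: reach_step; rewrite step_cons /act /= !(nfst_pair, nsnd_pair).
    exact: reach_refl.
  apply: (reach_trans (loop _ (leqnn _))).
  apply: (reach_trans (IHf _ _ Hf0 _)).
  apply: reach_step; rewrite step_cons /act /= !(nfst_pair, nsnd_pair).
  exact: reach_refl.
Qed.

(** * Approximations of the generators *)

(** An index [e] codes a triple [((q, w), m)]. The run depends on [q] and [w] alone; [m] makes [e],
    hence [time e s], at least [m]. *)
Definition start (e : nat) : nat :=
  npair (lcons (nfst (nfst e)) 0) (nsnd (nfst e)).

(* Pairs the state after [s] steps with the number of steps made before halting. *)
Definition stage (e s : nat) : nat :=
  iter s (fun z => if nfst (nfst z) == 0 then z
                   else npair (step (nfst z)) (nsnd z).+1) (npair (start e) 0).

Definition halted (e s : nat) : bool := nfst (nfst (stage e s)) == 0.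

(** Pairing with [e] gives distinct generators distinct times. *)
Definition time (e s : nat) : nat := npair e (nsnd (stage e s)).

Definition magn (t : nat) : nat := iteri t (fun i r => r * (3 * i.+1)) 1.

(* Index [0] stands for the element [b] of the group, and [e > 0] for a generator
   which is finally equal to a multiple of [b] if the machine [e] halts. *)
Definition gen (e s : nat) : nat :=
  if e == 0 then 1 else magn (time e s) + (nsnd (nfst (stage e s)) != 0).

Lemma cf_stage X e s : computable_from X e -> computable_from X s ->
  computable_from X (fun x => stage (e x) (s x)).
Proof.
move=> ce cs; rewrite /stage /start /lcons; computability.
by apply: cf_step; computability.
Qed.

Lemma cf_gen X e s : computable_from X e -> computable_from X s ->
  computable_from X (fun x => gen (e x) (s x)).
Proof.
move=> ce cs; rewrite /gen /magn /time; computability;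
  by apply: cf_stage; computability.
Qed.

Lemma stageS e s : stage e s.+1 =
  if halted e s then stage e s else npair (step (nfst (stage e s))) (nsnd (stage e s)).+1.
Proof. by []. Qed.

Lemma nfst_stage e s : nfst (stage e s) = iter s step (start e).
Proof.
elim: s => [|s IHs]; first by rewrite /stage /= nfst_pair.
rewrite stageS iterS -IHs /halted; case: ifP => [K0|_]; last by rewrite nfst_pair.
by rewrite /step K0.
Qed.

Lemma halted_stable e s n : halted e s -> stage e (n + s) = stage e s.
Proof.
move=> hs; elim: n => // n IHn.
by rewrite addSn stageS /halted IHn -/(halted e s) hs.
Qed.

Lemma clock e s : ~~ halted e s -> nsnd (stage e s) = s.
Proof.
elim: s => [|s IHs]; first by rewrite /stage /= nsnd_pair.
have [hs|nhs] := boolP (halted e s).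
  by rewrite /halted -add1n halted_stable // -/(halted e s) hs.
by rewrite stageS (negbTE nhs) nsnd_pair IHs.
Qed.

(** * Growth of the magnitudes and dominating generators *)

Lemma magn_gt0 t : 0 < magn t.
Proof. by elim: t => // t IHt; rewrite /= muln_gt0 IHt. Qed.

Lemma magn_mono t u : t <= u -> magn t <= magn u.
Proof.
elim: u => [|u IHu]; first by rewrite leqn0 => /eqP ->.
rewrite leq_eqVlt => /predU1P[-> //|/IHu/leq_trans]; apply.
by rewrite /= leq_pmulr.
Qed.

(** This is where the factor 3 in [magn] matters: $3M > M + 1$ for all $M \geq 1$, whereas $2M > M +
    1$ fails for $M = 1$. *)
Lemma magn_growth t : t.+1 * (magn t).+1 < magn t.+1.
Proof. by have := magn_gt0 t; rewrite /= -/(magn t); nia. Qed.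

Lemma dvdn_magn m t : 0 < m <= t -> m %| magn t.
Proof.
elim: t => [|t IHt]; first by case: m.
case/andP=> m_gt0; rewrite leq_eqVlt => /predU1P[->|lt_mt] /=.
  by rewrite mulnA dvdn_mull.
by rewrite dvdn_mulr // IHt // m_gt0.
Qed.

Lemma gen_magn e s t : (e != 0 -> time e s <= t) -> gen e s <= (magn t).+1.
Proof.
rewrite /gen; case: eqP => // _ /(_ isT)/magn_mono; have := magn_gt0 t.
by case: (_ != 0); lia.
Qed.

Lemma sum_count_mem n A (F : nat -> nat) : all (fun x => x < n) A ->
  \sum_(x <- A) F x = \sum_(y < n) count_mem (y : nat) A * F y.
Proof.
elim: A => [_|a A IHA] /=; first by rewrite big_nil big1.
case/andP=> lt_an /IHA; rewrite big_cons => ->.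
under [RHS]eq_bigr do rewrite mulnDl.
rewrite big_split /=; congr (_ + _).
rewrite (bigD1 (Ordinal lt_an)) //= eqxx mul1n big1 ?addn0 // => i.
by rewrite -val_eqE /= eq_sym => /negbTE ->.
Qed.

(** With [t.+1] the time of [x], the extra copy of [x] in [A] is worth at least [magn t.+1]. The
    other generators give [B] an advantage of at most [size B <= t.+1] copies of value at most
    [(magn t).+1], which is less by [magn_growth]. *)
Lemma sum_gen_lt n A B s (x : 'I_n) :
  all (fun x => x < n) A -> all (fun x => x < n) B ->
  x != 0 :> nat -> count_mem (x : nat) B < count_mem (x : nat) A ->
  size A + size B <= time x s ->
  (forall y : 'I_n, y != 0 :> nat ->
     count_mem (y : nat) A != count_mem (y : nat) B -> time y s <= time x s) ->
  \sum_(y <- B) gen y s < \sum_(y <- A) gen y s.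
Proof.
move=> ltA ltB x0 ltx le_t max_t.
have szB : size B = \sum_(y < n) count_mem (y : nat) B.
  by rewrite -sum1_size (sum_count_mem _ ltB); apply: eq_bigr => y _; rewrite muln1.
rewrite (sum_count_mem _ ltA) (sum_count_mem _ ltB).
rewrite (bigD1 x) //= [ltnRHS](bigD1 x) //=.
have t_gt0 : 0 < time x s.
  have := leq_trans ltx (count_size _ _); case: (size A) le_t => // k le_t _.
  exact: leq_trans le_t.
case Et: (time x s) t_gt0 => [//|t] _.
have genx : magn t.+1 <= gen x s by rewrite /gen (negbTE x0) Et leq_addr.
(* Generators of equal multiplicity cancel; any other one has time at most [t], since times are
   distinct and that of [x] is largest. *)
have bound : \sum_(y < n | y != x) count_mem (y : nat) B * gen y s <=
  \sum_(y < n | y != x) count_mem (y : nat) A * gen y s + size B * (magn t).+1.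
  rewrite szB big_distrl /= [X in _ <= _ + X](bigID (fun y => y != x)) /=.
  rewrite addnA -big_split /=; apply: leq_trans (leq_addr _ _).
  apply: leq_sum => y y_x.
  have [->|neq] := eqVneq (count_mem (y : nat) A) (count_mem (y : nat) B).
    exact: leq_addr.
  apply: leq_trans (leq_addl _ _); rewrite leq_mul2l gen_magn ?orbT // => y0.
  rewrite -ltnS -Et ltn_neqAle max_t // andbT.
  by apply: contraNneq y_x => /npair_inj1/val_inj ->.
have le_szB : size B * (magn t).+1 <= t.+1 * (magn t).+1.
  by rewrite leq_mul2r -Et (leq_trans _ le_t) ?leq_addl ?orbT.
apply: leq_ltn_trans (leq_add (leqnn _) bound) _.
rewrite addnCA addnC ltn_add2r.
apply: (@leq_trans ((count_mem (x : nat) B).+1 * gen x s)); last first.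
  by rewrite leq_mul2r ltx orbT.
rewrite mulSn addnC ltn_add2r.
exact: leq_ltn_trans le_szB (leq_trans (magn_growth t) genx).
Qed.

(* The generator of largest time dominates all the other ones. *)
Lemma sum_gen_neq A B s x : x != 0 -> count_mem x A != count_mem x B ->
  size A + size B <= time x s ->
  \sum_(y <- A) gen y s != \sum_(y <- B) gen y s.
Proof.
move=> x0 neqx le_t.
have [n [ltx ltA ltB]] : exists n, [/\ x < n, all (fun y => y < n) A
  & all (fun y => y < n) B].
  have lt_sumn C y : y \in C -> y <= sumn C.
    by elim: C => //= a C IHC; rewrite inE => /predU1P[->|/IHC]; lia.
  exists (x + sumn A + sumn B).+1; split; first by lia.
    by apply/allP => y /lt_sumn; lia.
  by apply/allP => y /lt_sumn; lia.
pose P (y : 'I_n) := (y != 0 :> nat) && (count_mem (y : nat) A != count_mem (y : nat) B).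
have Px : P (Ordinal ltx) by rewrite /P x0.
case: (@arg_maxnP _ (Ordinal ltx) P (fun y => time y s) Px) => y /andP[y0 neqy] max_y.
have le_ty : size A + size B <= time y s by apply: leq_trans le_t (max_y _ Px).
move: neqy; rewrite !neq_ltn => /orP[] lty; apply/orP.
  left; apply: (@sum_gen_lt n B A s y) => //; first by rewrite addnC.
  by move=> z z0 neqz; apply: max_y; rewrite /P z0 eq_sym.
right; apply: (@sum_gen_lt n A B s y) => //.
by move=> z z0 neqz; apply: max_y; rewrite /P z0.
Qed.

Lemma leq_time e s : ~~ halted e s -> s <= time e s.
Proof. by move=> /clock Es; rewrite /time Es; have := leq_npair e s; lia. Qed.

Lemma leq_time_index e s : e <= time e s.
Proof. by have := leq_npair e (nsnd (stage e s)); rewrite /time; lia. Qed.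

Lemma gen_halted e s n : halted e s -> gen e (n + s) = gen e s.
Proof. by move=> hs; rewrite /gen /time halted_stable. Qed.

(** From one stage to the next there are two cases. If a generator whose multiplicities differ is
    still running, its time is at least [s] and both equalities fail by [sum_gen_neq]. Otherwise all
    generators that matter have their final values. *)
Lemma sum_gen_stable A B s n : size A + size B <= s ->
  (\sum_(y <- A) gen y (n + s) == \sum_(y <- B) gen y (n + s)) =
  (\sum_(y <- A) gen y s == \sum_(y <- B) gen y s).
Proof.
move=> le_s; elim: n => // n <-; rewrite addSn.
have {}le_s : size A + size B <= n + s by lia.
move: (n + s) le_s => {n}s le_s.
have [/hasP[x _ /and3P[x0 neqx nhx]]|/hasPn same] :=
  boolP (has (fun x => [&& x != 0, count_mem x A != count_mem x B & ~~ halted x s])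
         (A ++ B)).
  rewrite !(negbTE (sum_gen_neq x0 neqx _)) // ?(leq_trans le_s (leq_time nhx)) //.
  (* The step leading to stage [s.+1] is counted even if the machine halts there. *)
  rewrite (leq_trans le_s) // /time stageS (negbTE nhx) nsnd_pair.
  by have := leq_npair x (nsnd (stage x s)).+1; rewrite (clock nhx); lia.
have [n lt_n] : exists n, all (fun y => y < n) (A ++ B).
  exists (sumn (A ++ B)).+1; apply/allP; elim: (A ++ B) => //= a C IHC y.
  by rewrite inE => /predU1P[->|/IHC]; lia.
move: lt_n; rewrite all_cat => /andP[ltA ltB].
(* The difference of the two sums does not change, stated without truncated subtraction. *)
have E : \sum_(y <- A) gen y s.+1 + \sum_(y <- B) gen y s =
         \sum_(y <- A) gen y s + \sum_(y <- B) gen y s.+1.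
  rewrite !(sum_count_mem _ ltA) !(sum_count_mem _ ltB) -!big_split /=.
  apply: eq_bigr => y _.
  have [->|neqy] := eqVneq (count_mem (y : nat) A) (count_mem (y : nat) B).
    by rewrite addnC.
  have y_AB : (y : nat) \in A ++ B.
    apply: contraNT neqy; rewrite mem_cat negb_or => /andP[yA yB].
    by rewrite (count_memPn yA) (count_memPn yB).
  have := same _ y_AB; rewrite neqy /= negb_and !negbK => /predU1P[->|hy].
    by rewrite /gen.
  by rewrite -[s.+1]add1n (gen_halted 1 hy).
by apply/eqP/eqP; lia.
Qed.

(** * The group *)

Definition wsum (l s : nat) : nat := lfold (fun x r => r + gen x s) l 0.

(** Concatenation with [l] reversed; order is irrelevant in an abelian group. *)
Definition ladd (l l' : nat) : nat := lfold lcons l l'.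

(* The word [npair l l'] denotes the formal difference of the lists coded by [l]
   and [l'], whose entries are indices of generators. *)
Definition wadd (u v : nat) : nat :=
  npair (ladd (nfst u) (nfst v)) (ladd (nsnd u) (nsnd v)).

Definition wopp (u : nat) : nat := npair (nsnd u) (nfst u).

Definition weq_at (s u v : nat) : bool :=
  wsum (nfst u) s + wsum (nsnd v) s == wsum (nfst v) s + wsum (nsnd u) s.

(** A code bounds the length of its word, so stage [u + v] is late enough for [sum_gen_stable]. *)
Definition weq (u v : nat) : bool := weq_at (u + v) u v.

Lemma wsum_code A s : wsum (lcode A) s = \sum_(x <- A) gen x s.
Proof.
suff E k : foldl (fun r x => r + gen x s) k A = k + \sum_(x <- A) gen x s.
  by rewrite /wsum lfold_code E.
elim: A k => [|a A IHA] k /=; first by rewrite big_nil addn0.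
by rewrite IHA big_cons addnA.
Qed.

Lemma wsum_ladd l l' s : wsum (ladd l l') s = wsum l s + wsum l' s.
Proof.
have [[A ->] [B ->]] := (lcode_surj l, lcode_surj l').
rewrite /ladd lfold_code; elim: A B => [|a A IHA] B /=.
  by rewrite (wsum_code [::]) big_nil.
by rewrite (IHA (a :: B)) (wsum_code (a :: A)) !wsum_code !big_cons addnCA addnA.
Qed.

Lemma cf_wsum X l s : computable_from X l -> computable_from X s ->
  computable_from X (fun x => wsum (l x) (s x)).
Proof.
move=> cl cs; apply: cf_lfold => //; computability.
by apply: cf_gen; [|apply: (cf_comp cs)]; computability.
Qed.

Lemma cf_ladd X l l' : computable_from X l -> computable_from X l' ->
  computable_from X (fun x => ladd (l x) (l' x)).
Proof. by move=> cl cl'; apply: cf_lfold => //; rewrite /lcons; computability. Qed.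

Lemma cf_weq X u v : computable_from X u -> computable_from X v ->
  computable_from X (fun x => weq (u x) (v x) : nat).
Proof.
move=> cu cv; rewrite /weq /weq_at.
by computability; apply: cf_wsum; computability.
Qed.

Lemma weq_stable u v s : u + v <= s -> weq_at s u v = weq u v.
Proof.
move=> le_s; rewrite -(subnK le_s) /weq /weq_at.
have [A Au] := lcode_surj (nfst u); have [A' A'u] := lcode_surj (nsnd u).
have [B Bv] := lcode_surj (nfst v); have [B' B'v] := lcode_surj (nsnd v).
rewrite Au A'u Bv B'v !wsum_code -!big_cat; apply: sum_gen_stable.
have := leq_npair (nfst u) (nsnd u); have := leq_npair (nfst v) (nsnd v).
rewrite !npair_eta Au A'u Bv B'v !size_cat.
have := (size_lcode A, size_lcode A', size_lcode B, size_lcode B').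
by case=> [[[]]]; lia.
Qed.

(** The congruence laws follow by moving all comparisons to a common late stage, where they are
    linear arithmetic. *)
Lemma weq_eventually u v s0 : (forall s, s0 <= s -> weq_at s u v) -> weq u v.
Proof. by move=> /(_ (s0 + (u + v)) (leq_addr _ _)); rewrite weq_stable ?leq_addl. Qed.

Lemma weq_refl u : weq u u.
Proof. by rewrite /weq /weq_at. Qed.

Lemma weq_sym u v : weq u v = weq v u.
Proof. by rewrite /weq /weq_at (addnC u v) eq_sym. Qed.

Lemma weq_trans v u w : weq u v -> weq v w -> weq u w.
Proof.
move=> uv vw; apply: (@weq_eventually _ _ (u + v + w)) => s le_s.
move: uv vw; rewrite -(@weq_stable u v s) -?(@weq_stable v w s); try lia.
by rewrite /weq_at; lia.
Qed.

Lemma weq_wadd u u' v v' : weq u u' -> weq v v' -> weq (wadd u v) (wadd u' v').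
Proof.
move=> uu' vv'; apply: (@weq_eventually _ _ (u + u' + v + v')) => s le_s.
move: uu' vv'; rewrite -(@weq_stable u u' s) -?(@weq_stable v v' s); try lia.
by rewrite /weq_at /wadd !(nfst_pair, nsnd_pair) !wsum_ladd; lia.
Qed.

Lemma weq_wopp u v : weq u v -> weq (wopp u) (wopp v).
Proof.
move=> uv; apply: (@weq_eventually _ _ (u + v)) => s le_s.
by move: uv; rewrite -(@weq_stable _ _ s) // /weq_at /wopp !(nfst_pair, nsnd_pair); lia.
Qed.

(** * Least representatives and the quotient group *)

Lemma canon_subproof u : exists v, weq u v.
Proof. by exists u; apply: weq_refl. Qed.

Definition canon (u : nat) : nat := ex_minn (canon_subproof u).

Lemma weq_canon u : weq u (canon u).
Proof. by rewrite /canon; case: ex_minnP. Qed.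

Lemma canon_eq u v : (canon u == canon v) = weq u v.
Proof.
apply/eqP/idP => [Euv|uv].
  by apply: weq_trans (weq_canon u) _; rewrite Euv weq_sym weq_canon.
rewrite /canon; apply: eq_ex_minn => w; apply/idP/idP; apply: weq_trans => //.
by rewrite weq_sym.
Qed.

Lemma canonK u : canon (canon u) == canon u.
Proof. by rewrite canon_eq weq_sym weq_canon. Qed.

Lemma cf_canon X u : computable_from X u -> computable_from X (fun x => canon (u x)).
Proof.
move=> cu; apply: (cf_comp _ cu); apply: cf_min.
by apply: cf_weq; computability.
Qed.

Definition wgroup : Type := {u : nat | canon u == u}.

HB.instance Definition _ := SubType.on wgroup.
HB.instance Definition _ := Choice.on wgroup.

Definition cls (u : nat) : wgroup := exist _ (canon u) (canonK u).

Lemma val_cls u : val (cls u) = canon u.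
Proof. by []. Qed.

Lemma clsE u v : (cls u == cls v) = weq u v.
Proof. by rewrite -val_eqE /= canon_eq. Qed.

Lemma clsK x : cls (val x) = x.
Proof. by apply/val_inj/eqP; rewrite val_cls (valP x). Qed.

Definition gadd (x y : wgroup) : wgroup := cls (wadd (val x) (val y)).
Definition gopp (x : wgroup) : wgroup := cls (wopp (val x)).

Lemma gadd_cls u v : gadd (cls u) (cls v) = cls (wadd u v).
Proof.
apply/eqP; rewrite clsE weq_wadd // val_cls weq_sym; exact: weq_canon.
Qed.

Lemma gopp_cls u : gopp (cls u) = cls (wopp u).
Proof. by apply/eqP; rewrite clsE weq_wopp // weq_sym weq_canon. Qed.

Lemma weq_always u v : (forall s, weq_at s u v) -> weq u v.
Proof. exact. Qed.

Lemma gaddA : associative gadd.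
Proof.
move=> x y z; rewrite -[x]clsK -[y]clsK -[z]clsK !gadd_cls.
apply/eqP; rewrite clsE weq_always // => s.
by rewrite /weq_at /wadd !(nfst_pair, nsnd_pair) !wsum_ladd; lia.
Qed.

Lemma gaddC : commutative gadd.
Proof.
move=> x y; apply/eqP; rewrite clsE weq_always // => s.
by rewrite /weq_at /wadd !(nfst_pair, nsnd_pair) !wsum_ladd; lia.
Qed.

Lemma gadd0 : left_id (cls (npair 0 0)) gadd.
Proof.
move=> x; rewrite -[x]clsK gadd_cls; apply/eqP; rewrite clsE weq_always // => s.
rewrite /weq_at /wadd !(nfst_pair, nsnd_pair) !wsum_ladd.
by rewrite (wsum_code [::]) big_nil; lia.
Qed.

Lemma gaddN : left_inverse (cls (npair 0 0)) gopp gadd.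
Proof.
move=> x; rewrite -[x]clsK gopp_cls gadd_cls; apply/eqP; rewrite clsE weq_always // => s.
rewrite /weq_at /wadd /wopp !(nfst_pair, nsnd_pair) !wsum_ladd.
by rewrite (wsum_code [::]) big_nil; lia.
Qed.

HB.instance Definition _ := GRing.isZmodule.Build wgroup gaddA gaddC gadd0 gaddN.

Lemma gofK_subproof : ocancel (insub : nat -> option wgroup) val.
Proof. exact: insubK. Qed.

Definition natG : natZmodType :=
  @NatZmodType wgroup val insub (@valK _ _ _) gofK_subproof.

Lemma gdom_natG i : gdom natG i = (canon i == i).
Proof. by rewrite /gdom /=; case: insubP => [? -> //|/negbTE]. Qed.

Lemma nat_coloring_val r (c : natG -> 'I_r) (x : wgroup) :
  nat_coloring c (val x) = c x.
Proof. by rewrite /nat_coloring /= valK. Qed.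

Lemma computable_natG : computable_group natG.
Proof.
have cdom f : computable f -> computable (fun z => canon (f z) == f z : nat).
  by move=> cf_; rewrite /computable; computability; apply: cf_canon.
split.
- apply: (@cf_ext _ (fun i => canon i == i)); first by move=> i; rewrite gdom_natG.
  by apply: cdom; apply: cf_id.
- apply: (@cf_ext _ (fun z =>
    if (canon (nfst z) == nfst z) && (canon (nsnd z) == nsnd z)
    then canon (wadd (nfst z) (nsnd z)) else 0)).
    move=> z; rewrite /nat_add /=.
    case: insubP => [u -> <-|/negbTE -> //].
    by case: insubP => [v -> <-|/negbTE -> //].
  apply: cf_if; last by computability.
    by apply: cf_and; apply: cdom; rewrite /computable; computability.
  by apply: cf_canon; rewrite /wadd; computability; apply: cf_ladd; computability.
- apply: (@cf_ext _ (fun z => if canon z == z then canon (wopp z) else 0)).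
    by move=> z; rewrite /nat_opp /=; case: insubP => [u -> <-|/negbTE -> //].
  apply: cf_if; last by computability.
    by apply: cdom; apply: cf_id.
  by apply: cf_canon; rewrite /wopp; computability.
Qed.

(** [letter 0] is the element $b$, of value 1 at every stage. *)
Definition letter (e : nat) : wgroup := cls (npair (lcons e 0) 0).

Lemma wsum_letter e s : wsum (lcons e 0) s = gen e s.
Proof. by rewrite (wsum_code [:: e]) big_seq1. Qed.

Lemma letter0_neq0 : letter 0 != 0%R.
Proof.
rewrite clsE; apply/negP; rewrite /weq /weq_at !(nfst_pair, nsnd_pair) wsum_letter.
by rewrite (wsum_code [::]) big_nil.
Qed.

Lemma letter_mulrn e N s0 : (forall s, s0 <= s -> gen e s = N) ->
  letter e = (letter 0 *+ N)%R.
Proof.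
(* [w k] is the word made of [k] copies of $b$; its value is [k] at all stages. *)
move=> Eg; pose w k := iter k (wadd (npair (lcons 0 0) 0)) (npair 0 0).
have Ew k : (letter 0 *+ k)%R = cls (w k).
  elim: k => [|k IHk]; first by rewrite mulr0n.
  by rewrite mulrS IHk; apply: gadd_cls.
have wsum0 s : wsum 0 s = 0 by rewrite (wsum_code [::]) big_nil.
have wE k s : wsum (nfst (w k)) s = k /\ wsum (nsnd (w k)) s = 0.
  elim: k => [|k [IH1 IH2]] /=; first by rewrite nfst_pair nsnd_pair wsum0.
  by rewrite /wadd !(nfst_pair, nsnd_pair) !wsum_ladd IH1 IH2 wsum_letter wsum0.
rewrite Ew; apply/eqP; rewrite clsE; apply: (@weq_eventually _ _ s0) => s /Eg Es.
have [E1 E2] := wE N s.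
by rewrite /weq_at E1 E2 !(nfst_pair, nsnd_pair) wsum_letter Es wsum0.
Qed.

Lemma letter_halting m q w z : 0 < m -> eval (fun=> 0) q w z ->
  exists2 N, m %| N &
    letter (npair (npair (pcode q) w) m) = (letter 0 *+ (N + (z != 0)))%R.
Proof.
move=> m_gt0 /reach_eval/(_ 0); set e := npair _ m => -[s Es].
have st : nfst (stage e s) = npair 0 z.
  by rewrite nfst_stage /start /e !(nfst_pair, nsnd_pair).
have hs : halted e s by rewrite /halted st nfst_pair.
have le_me : m <= e by have := leq_npair (npair (pcode q) w) m; rewrite /e; lia.
(* Divisibility by [m] comes from [m <= e <= time e s]. *)
exists (magn (time e s)).
  by rewrite dvdn_magn // m_gt0 (leq_trans le_me) ?leq_time_index.
apply: (@letter_mulrn _ _ s) => t /subnK <-; rewrite gen_halted //.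
(* As [0 < m <= e], the index [e] is not the one reserved for $b$. *)
by rewrite /gen -[e == 0]negbK -lt0n (leq_trans m_gt0) // st nsnd_pair.
Qed.

(** * Paths from separating sets *)

(* Binary strings are identified with the positive numbers whose binary expansion
   is the string preceded by a [1]. *)
Definition bnum_from (w : nat) (s : seq nat) : nat :=
  foldl (fun r b => 2 * r + b) w s.

Definition bnum : seq nat -> nat := bnum_from 1.

(** Converts such a number into the [CodeSeq] code of its string. Bits are removed from the end, and
    [2 ^ a * (2 * c).+1] is the code of the list with head [a] and tail coded by [c]. *)
Definition bstr (w : nat) : nat :=
  nsnd (iter w (fun p => if nfst p <= 1 then p else
    npair (nfst p)./2 (2 ^ odd (nfst p) * (2 * nsnd p).+1)) (npair w 0)).

Notation binary s := (all (fun a => a < 2) s).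

Lemma bnum_rcons s b : bnum (rcons s b) = 2 * bnum s + b.
Proof. by rewrite /bnum /bnum_from -cats1 foldl_cat. Qed.

Lemma size_bnum s : size s < bnum s.
Proof. by elim/last_ind: s => // s b IHs; rewrite size_rcons bnum_rcons; lia. Qed.

Lemma bstrK s : binary s -> bstr (bnum s) = CodeSeq.code s.
Proof.
suff E k t : size s <= k -> binary s -> nsnd (iter k (fun p =>
    if nfst p <= 1 then p else
    npair (nfst p)./2 (2 ^ odd (nfst p) * (2 * nsnd p).+1))
    (npair (bnum s) (CodeSeq.code t))) = CodeSeq.code (s ++ t).
  by move=> bs; rewrite -[s in RHS]cats0 -(E (bnum s)) // ltnW ?size_bnum.
elim/last_ind: s k t => [|s b IHs] k t.
  by move=> _ _; elim: k => [|k]; rewrite ?nsnd_pair // iterSr /= nfst_pair.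
rewrite size_rcons all_rcons; case: k => // k le_sk /andP[lt_b2 bs].
rewrite iterSr !(nfst_pair, nsnd_pair) bnum_rcons ifN; last first.
  by have := size_bnum s; lia.
have -> : (2 * bnum s + b)./2 = bnum s by lia.
have -> : odd (2 * bnum s + b) = b :> nat by lia.
by rewrite mul2n -[_ * _]/(CodeSeq.code (b :: t)) IHs // cat_rcons.
Qed.

Lemma cf_bstr X w : computable_from X w -> computable_from X (fun x => bstr (w x)).
Proof. by move=> cw; rewrite /bstr; computability. Qed.

(** With [bnum_from_surj]: the extensions of a node by [d] bits fill an interval of length [2 ^ d],
    so looking for one in a tree is a bounded search. *)
Lemma bnum_from_bound w d s : binary s -> size s = d ->
  exists2 u, u < 2 ^ d & bnum_from w s = w * 2 ^ d + u.
Proof.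
move=> bs <-{d}; elim/last_ind: s bs => [|s b IHs].
  by exists 0; rewrite ?muln1 ?addn0.
rewrite all_rcons => /andP[lt_b /IHs[u lt_u E]].
exists (2 * u + b); first by rewrite size_rcons expnS; lia.
by rewrite /bnum_from -cats1 foldl_cat size_cat addn1 expnS /= -/(bnum_from w s) E; lia.
Qed.

Lemma bnum_from_surj d u : u < 2 ^ d ->
  exists s, [/\ binary s, size s = d & forall w, bnum_from w s = w * 2 ^ d + u].
Proof.
elim: d u => [|d IHd] u.
  by case: u => // _; exists [::]; split=> // w; rewrite muln1 addn0.
rewrite expnS => lt_u; have [|s [bs sz E]] := IHd u./2; first by lia.
exists (rcons s (odd u)); split; first by rewrite all_rcons bs andbT; case: odd.
  by rewrite size_rcons sz.
by move=> w; rewrite /bnum_from -cats1 foldl_cat /= -/(bnum_from w s) E; lia.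
Qed.

(** Only finitely many binary strings are shorter than [d]; a member of [T] avoiding them is
    truncated. *)
Lemma infinite_binary_tree_level (T : pred (seq nat)) d :
  binary_tree T -> infinite_tree T -> exists2 s, T s & size s = d.
Proof.
move=> [treeT binT] infT.
have [l Hl] : exists l : seq (seq nat), forall s, binary s -> size s < d -> s \in l.
  elim: d => [|d [l Hl]]; first by exists [::].
  exists ([::] :: [seq b :: s | b <- [:: 0; 1], s <- l]) => -[//|b s] /andP[lt_b bs] lt_sd.
  rewrite inE; apply/orP; right; apply/allpairsP.
  exists (b, s); split=> //=; last exact: Hl.
  by case: b lt_b {lt_sd} => [|[|b]].
have [s Ts s_l] := infT l; exists (take d s).
  by exact: treeT (prefix_take _ _) Ts.
by rewrite size_takel // leqNgt; apply: contraNN s_l; apply: Hl; apply: binT.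
Qed.

Lemma PA_degree_of_separation X :
  (forall q, exists2 g : pred nat, computable_from X (fun w => g w : nat)
     & forall w (z : bool), eval (fun=> 0) q w z -> g w = z) ->
  PA_degree X.
Proof.
move=> sepX T cT binT infT; have [treeT bT] := binT.
pose T' w := T (CodeSeq.decode (bstr w)).
(* Node [w] has an extension in [T] by [d] further bits. *)
pose ext w d := has (fun u => T' (w * 2 ^ d + u)) (iota 0 (2 ^ d)).
have extP s d : binary s ->
    reflect (exists t, [/\ binary t, size t = d & T (s ++ t)]) (ext (bnum s) d).
  move=> bs; have T'E t : binary t -> T (s ++ t) = T' (bnum_from (bnum s) t).
    move=> bt; rewrite /T' /bnum_from -foldl_cat -/(bnum (s ++ t)) bstrK ?CodeSeq.codeK //.
    by rewrite all_cat bs.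
  apply: (iffP hasP) => [[u]|[t [bt sz Tst]]].
    rewrite mem_iota => /= /bnum_from_surj[t [bt sz E]].
    by rewrite -E -T'E //; exists t.
  have [u lt_u E] := bnum_from_bound (bnum s) bt sz.
  by exists u; rewrite ?mem_iota // -E -T'E.
have cext (f g : nat -> nat) : computable f -> computable g ->
    computable (fun z => ext (f z) (g z) : nat).
  move=> cf_ cg; apply: cf_has; first by rewrite /computable; computability.
  apply: (cf_comp cT); apply: cf_bstr.
  apply: cf_add; last by computability.
  apply: cf_mul; first by apply: (cf_comp cf_); computability.
  by apply: cf_exp; [|apply: (cf_comp cg)]; computability.
(* At node [w], [q] seeks a depth that some child fails to reach, and outputs 1 if child 0 fails
   there, 0 otherwise: the output is the child to follow. *)
have [||q Hq] := @eval_search (fun=> 0)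
    (fun w d => ~~ (ext (2 * w) d && ext (2 * w + 1) d)) (fun w d => ~~ ext (2 * w) d).
- by apply: cf_neg; apply: cf_and; apply: cext; rewrite /computable; computability.
- by apply: cf_neg; apply: cext; rewrite /computable; computability.
have [g cg Hg] := sepX q.
pose W k := iter k (fun w => 2 * w + g w) 1; pose f k := g (W k) : nat.
have bf l : binary (mkseq f l).
  by apply/allP => _ /mapP[k _ ->]; rewrite /f; case: (g _).
have bnumf l : bnum (mkseq f l) = W l.
  by elim: l => // l IHl; rewrite mkseqS bnum_rcons IHl.
exists f.
  apply: (cf_comp cg); apply: cf_iter; computability.
  by apply: (cf_comp cg); computability.
(* Invariant: the nodes chosen by [g] have extensions of every length. *)
have alive l d : ext (W l) d.
  elim: l d => [|l IHl] d.
    have [s Ts sz] := infinite_binary_tree_level d binT infT.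
    by apply/(@extP [::]) => //; exists s; split=> //; apply: bT.
  have childE (b : bool) : 2 * W l + b = bnum (rcons (mkseq f l) b).
    by rewrite bnum_rcons bnumf.
  have bchild (b : bool) : binary (rcons (mkseq f l) b).
    by rewrite all_rcons bf; case: b.
  (* A long enough extension of the node passes through one child and can be shortened to the depth
     asked of that child. *)
  have some_child d0 d1 : ext (2 * W l) d0 || ext (2 * W l + 1) d1.
    have /(extP _ _ (bf l))[t [bt sz Tt]] : ext (bnum (mkseq f l)) (maxn d0 d1).+1.
      by rewrite bnumf.
    case: t bt sz Tt => [//|b t] /= /andP[lt_b bt] [sz] Tt.
    have sub (c : bool) e : b = c :> nat -> e <= size t -> ext (2 * W l + c) e.
      move=> Ebc le_e; rewrite childE; apply/(extP _ _ (bchild c)).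
      exists (take e t); split.
      - by move: bt; rewrite -{1}(cat_take_drop e t) all_cat => /andP[].
      - by rewrite size_takel.
      rewrite cat_rcons -Ebc; apply: treeT Tt.
      by rewrite prefix_catr // eqxx prefix_cons eqxx prefix_take.
    case: b lt_b {Tt} sub => [|[|//]] _ sub.
      by have := sub false d0 erefl; rewrite /= addn0 sz leq_maxl => ->.
    by rewrite (sub true) ?orbT // sz leq_maxr.
  (* If the chosen child fails at depth [d], then [q] halts and [g] agrees with it, so the sibling
     fails at the depth [k] found by [q], against [some_child]. *)
  rewrite /= -/(W l); apply: contraT => dead.
  have [|k Pk /Hg] := Hq (W l) d.
    apply: contra dead => /andP[e0 e1]; by case: (g _); rewrite ?addn0.
  case: (g _) dead => dead /esym.
    move=> /negbTE dead0; have := some_child k d.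
    by rewrite dead0 (negbTE dead).
  move/negbFE=> live0; rewrite live0 /= in Pk; rewrite addn0 in dead.
  by have := some_child d k; rewrite (negbTE dead) (negbTE Pk).
move=> l; have := alive l 0; rewrite -bnumf => /(extP _ _ (bf l))[t [_ /size0nil ->]].
by rewrite cats0.
Qed.

(** * Separation by colorings without solutions *)

Local Open Scope ring_scope.

Theorem theorem3p3 (n : nat) (n_ge2 : (2 <= n)%N) :
  exists G : natZmodType,
    computable_group G /\
    exists2 b : G, b != 0 &
      forall (r : nat) (c : G -> 'I_r), (1 < r)%N ->
        ~ (exists x y : {ffun 'I_n -> G},
             \sum_(i < n) (x i - y i) = b /\ pairwise_monochromatic c x y) ->
        (exists2 m : int, 0 < m &
           exists j : 'I_r, forall k : int, c (b *~ (k * m)) = j) ->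
        PA_degree (nat_coloring c).
Proof.
exists natG; split; first exact: computable_natG.
exists (letter 0); first exact: letter0_neq0.
move=> r c _ nosol [[m|//] m_gt0 [j cj]]; have {}m_gt0 : (0 < m)%N by [].
have cN N : (m %| N)%N -> c (letter 0 *+ N) = j.
  by case/dvdnP=> k ->; rewrite -(cj k) -PoszM.
apply: PA_degree_of_separation => q.
pose e w := npair (npair (pcode q) w) m.
(* The separating set consists of the inputs whose generator does not have the color [j] of the
   multiples of $mb$. *)
exists (fun w => nat_coloring c (val (letter (e w))) != j).
  apply: cf_neg; apply: cf_eq; last exact: cf_const.
  apply: cf_oracle; apply: cf_canon.
  by rewrite /lcons /e; computability.
move=> w z /(letter_halting m_gt0)[N dvd_mN].
rewrite -/(e w) => Ew; rewrite nat_coloring_val Ew.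
case: z Ew => [Ew|_]; last by rewrite addn0 cN ?eqxx.
apply/negP => /eqP/val_inj cj'; apply: nosol.
(* Two distinct positions, one for $(N+1)b$ among the $x_i$ and one for $Nb$ among the $y_i$. *)
pose i0 : 'I_n := Ordinal (ltnW n_ge2); pose i1 : 'I_n := Ordinal n_ge2.
exists [ffun i => if i == i0 then letter 0 *+ (N + 1) else 0].
exists [ffun i => if i == i1 then letter 0 *+ N else 0].
split.
  under eq_bigr do rewrite !ffunE.
  rewrite big_split /= sumrN -!big_mkcond /= !big_pred1_eq.
  by rewrite mulrnDr addrC addKr.
(* The padding has color [j] too, as 0 is a multiple of $mb$. *)
have c0 : c 0 = j by rewrite -[0](mulr0n (letter 0)) cN.
move=> i; rewrite !ffunE; case: eqP => [->|_] /=; first by rewrite c0.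
by case: ifP => _; rewrite c0 // cN.
Qed.
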